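(* Let $(z,r)\in Z\times\mathbb{R}$. The following assertions are equivalent: (i) $(z,r)\notin \mathcal{N}$; (ii) there exist $(w,\beta)\in W\times\mathbb{R}$ and $\gamma\in\mathbb{R}$ such that $\langle (z',r'),(w,\beta)\rangle\le\gamma<\langle (z,r),(w,\beta)\rangle$ for all $(z',r')\in\mathcal{H}$; (iii) there exists $(w,\beta)\in W\times\mathbb{R}$ such that $\langle (z',r')-(z,r),(w,\beta)\rangle<0$ for all $(z',r')\in\mathcal{H}$.
   Context: Setting: $(X,Y)$ and $(Z,W)$ are separated dual pairs of real vector spaces, i.e. there are bilinear forms on $X\times Y$ and on $Z\times W$, both denoted $\langle\cdot,\cdot\rangle$, such that $\langle x_0,y\rangle=0$ for all $y\in Y$ implies $x_0=0$, and $\langle x,y_0\rangle=0$ for all $x\in X$ implies $y_0=0$ (and likewise for $(Z,W)$). No topology is assumed. $A:X\to Z$ is a linear map with adjoint $A^*:W\to Y$, a linear map satisfying $\langle x,A^*w\rangle=\langle Ax,w\rangle$ for all $x\in X$, $w\in W$ (assumed to exist). $P\subset X$ and $Q\subset Z$ are convex cones (nonempty, and $\alpha u+\beta v$ is in the cone for all $\alpha,\beta\ge 0$ and $u,v$ in the cone); $b\in Z$, $c\in Y$. Dual cones: $P^*=\{y\in Y:\langle x,y\rangle\ge 0\ \forall x\in P\}$, $Q^*=\{w\in W:\langle q,w\rangle\ge 0\ \forall q\in Q\}$. Feasible sets: $F(\mathcal{P})=\{x\in P: Ax-b\in Q\}$ and $F(\mathcal{D})=\{w\in Q^*:-A^*w+c\in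 P^*\}$; both are assumed nonempty. Definitions: $\mathcal{H}=\bigcup_{x\in P}\big((Ax-b-Q)\times[\langle x,c\rangle,+\infty[\big)\subset Z\times\mathbb{R}$; $v_{\mathcal{D}}(z)=\sup\{\langle b+z,w\rangle:w\in F(\mathcal{D})\}$ for $z\in Z$ (possibly $+\infty$); $\mathcal{N}=\mathrm{epi}\,v_{\mathcal{D}}=\{(z,r)\in Z\times\mathbb{R}: v_{\mathcal{D}}(z)\le r\}$. The pairing of $Z\times\mathbb{R}$ with $W\times\mathbb{R}$ is $\langle (z,r),(w,\beta)\rangle=\langle z,w\rangle+r\beta$. *)

(* Defs.v *)
From mathcomp Require Import all_boot all_order all_algebra.
From mathcomp Require Import sesquilinear.
From mathcomp Require Import boolp classical_sets set_interval reals.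
From mathcomp Require Import constructive_ereal ereal.
Set Implicit Arguments.
Unset Strict Implicit.
Unset Printing Implicit Defensive.
Import Order.TTheory GRing.Theory Num.Theory.
Local Open Scope classical_set_scope.
Local Open Scope ring_scope.

(* A pairing of real vector spaces is a bilinear map
   [bX : {bilinear X -> Y -> R | *%R & *%R}], scalars acting on R by
   multiplication; no topology is involved. *)

Definition separated_pairing (R : realType) (X Y : lmodType R)
    (bX : {bilinear X -> Y -> R | *%R & *%R}) : Prop :=
  (forall x0 : X, (forall y : Y, bX x0 y = 0) -> x0 = 0) /\
  (forall y0 : Y, (forall x : X, bX x y0 = 0) -> y0 = 0).

Definition adjoint_maps (R : realType) (X Y Z W : lmodType R)
    (bX : {bilinear X -> Y -> R | *%R & *%R})
    (bZ : {bilinear Z -> W -> R | *%R & *%R})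
    (A : {linear X -> Z}) (As : {linear W -> Y}) : Prop :=
  forall (x : X) (w : W), bX x (As w) = bZ (A x) w.

Definition convex_cone (R : realType) (V : lmodType R) (P : set V) : Prop :=
  P !=set0 /\
  forall (a b : R) (u v : V),
    0 <= a -> 0 <= b -> P u -> P v -> P (a *: u + b *: v).

Definition dual_cone (R : realType) (X Y : lmodType R)
    (bX : {bilinear X -> Y -> R | *%R & *%R}) (P : set X) : set Y :=
  [set y | forall x, P x -> 0 <= bX x y].

Definition feasible_primal (R : realType) (X Z : lmodType R)
    (A : {linear X -> Z}) (P : set X) (Q : set Z) (b : Z) : set X :=
  [set x | P x /\ Q (A x - b)].

Definition feasible_dual (R : realType) (X Y Z W : lmodType R)
    (bX : {bilinear X -> Y -> R | *%R & *%R})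
    (bZ : {bilinear Z -> W -> R | *%R & *%R})
    (As : {linear W -> Y}) (P : set X) (Q : set Z) (c : Y) : set W :=
  [set w | dual_cone bZ Q w /\ dual_cone bX P (- As w + c)].

Definition primal_set (R : realType) (X Y Z : lmodType R)
    (bX : {bilinear X -> Y -> R | *%R & *%R})
    (A : {linear X -> Z}) (P : set X) (Q : set Z) (b : Z) (c : Y) :
    set (Z * R) :=
  \bigcup_(x in P) ([set A x - b - q | q in Q] `*` `[bX x c, +oo[).

Definition dual_value (R : realType) (X Y Z W : lmodType R)
    (bX : {bilinear X -> Y -> R | *%R & *%R})
    (bZ : {bilinear Z -> W -> R | *%R & *%R})
    (As : {linear W -> Y}) (P : set X) (Q : set Z) (b : Z) (c : Y) (z : Z) :
    \bar R :=
  ereal_sup [set (bZ (b + z) w)%:E | w in feasible_dual bX bZ As P Q c].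

Definition epigraph (R : realType) (T : Type) (f : T -> \bar R) :
    set (T * R) :=
  [set p | (f p.1 <= p.2%:E)%E].

Definition prod_pairing (R : realType) (Z W : lmodType R)
    (bZ : {bilinear Z -> W -> R | *%R & *%R}) (p : Z * R) (q : W * R) : R :=
  bZ p.1 q.1 + p.2 * q.2.

(* Main.v *)
Require Import Defs.
From mathcomp Require Import all_boot all_order all_algebra.
From mathcomp Require Import sesquilinear.
From mathcomp Require Import boolp classical_sets set_interval reals.
From mathcomp Require Import constructive_ereal ereal.
From mathcomp Require Import lra.
Import Order.TTheory GRing.Theory Num.Theory.
Local Open Scope classical_set_scope.
Local Open Scope ring_scope.

(** A functional that strictly separates a point from the primal set H is, up
    to scaling, either a dual feasible point or an improving recession direction
    of the dual program; the separation condition records its dual objective.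

    If (z, r) lies outside the epigraph N, some dual feasible w has
    r < <b + z, w>; weak duality bounds the functional (w, -1) on H by
    - <b, w>, which is less than its value <z, w> - r at (z, r)
    ([dual_feasible_separates]).  This gives (ii), and (ii) implies (iii) by
    subtracting.

    Conversely, let (w, beta) be as in (iii).  As P and Q are cones, H + (b, 0)
    is stable under nonnegative scaling, so a functional bounded above on H is
    nonpositive on that cone.  Testing it on the rays spanned by P, by - Q and
    by the vertical axis shows that beta <= 0, that w is in Q^*, and that
    - A^* w - beta c is in P^*; testing it at the apex (- b, 0) gives
    0 < <b + z, w> + r beta ([strict_separation_signs]).  When beta < 0, the
    point w / - beta is dual feasible and <b + z, w / - beta> > r.  When
    beta = 0, w is a recession direction of the dual feasible set along which
    the objective strictly increases, so moving far enough from any dual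
    feasible point beats r.  In both cases the dual value at z exceeds r. *)

Section ConvexCone.
Context {R : realType} {V : lmodType R} {P : set V}.
Hypothesis coneP : convex_cone P.

Lemma convex_cone_scale {t : R} {u : V} : 0 <= t -> P u -> P (t *: u).
Proof.
by move=> t0 Pu; move: (coneP.2 t 0 u u t0 (lexx 0) Pu Pu); rewrite scale0r addr0.
Qed.

Lemma convex_cone0 : P 0.
Proof.
by have [[u Pu] _] := coneP; rewrite -(scale0r u); exact: convex_cone_scale.
Qed.

End ConvexCone.

Lemma ray_bounded_above_le0 {R : realType} (a m : R) :
  (forall t, 0 <= t -> t * a < m) -> a <= 0.
Proof.
move=> bounded; rewrite leNgt; apply/negP => a0.
have := bounded (`|m| / a) (divr_ge0 (normr_ge0 m) (ltW a0)).
by rewrite divfK ?gt_eqF// ltNge ler_norm.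
Qed.

Section Duality.
Context {R : realType} {X Y Z W : lmodType R}.
Context {bX : {bilinear X -> Y -> R | *%R & *%R}}.
Context {bZ : {bilinear Z -> W -> R | *%R & *%R}}.
Context {A : {linear X -> Z}} {As : {linear W -> Y}}.
Context {P : set X} {Q : set Z} {b : Z} {c : Y}.

Lemma notin_epigraph_dual_value (z : Z) (r : R) :
  ~ epigraph (dual_value bX bZ As P Q b c) (z, r) <->
  exists2 w, feasible_dual bX bZ As P Q c w & r < bZ (b + z) w.
Proof.
rewrite /epigraph /dual_value /=; split.
  move/negP; rewrite -ltNge => /ereal_sup_gt[_ [w Fw <-]].
  by rewrite lte_fin; exists w.
move=> [w Fw rw]; apply/negP; rewrite -ltNge.
apply: (@lt_le_trans _ _ (bZ (b + z) w)%:E); first by rewrite lte_fin.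
by apply: ereal_sup_ubound; exists w.
Qed.

Hypothesis adjA : adjoint_maps bX bZ A As.

(** Weak duality: subtracting a point of Q and raising the cost above <x, c>
    can only decrease the functional, and the x-dependence of what remains is
    <x, A^* w - c>, which is nonpositive. *)
Lemma dual_feasible_separates {w : W} {h : Z * R} :
    feasible_dual bX bZ As P Q c w -> primal_set bX A P Q b c h ->
  prod_pairing bZ h (w, -1) <= - bZ b w.
Proof.
case: h => _ s [wQ wP] [x Px [/= [q Qq <-]]].
rewrite /= in_itv/= andbT /prod_pairing/= => cs.
have := wQ _ Qq; have := wP _ Px.
rewrite linearDr linearNr adjA !linearBl/= => xw qw.
lra.
Qed.

Hypotheses (coneP : convex_cone P) (coneQ : convex_cone Q).

(** What the existence of a strictly separating (w, beta) amounts to, once the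
    points of the primal set are eliminated. *)
Lemma strict_separation_signs {z : Z} {r : R} {w : W} {beta : R} :
    (forall h, primal_set bX A P Q b c h ->
       prod_pairing bZ (h - (z, r)) (w, beta) < 0) ->
  [/\ beta <= 0, dual_cone bZ Q w, dual_cone bX P (- As w - beta *: c)
    & 0 < bZ (b + z) w + r * beta].
Proof.
move=> sep.
(* The common form of the four tests: q, x and s are the contributions of Q, P
   and the vertical axis. *)
have test x q s : P x -> Q q -> 0 <= s ->
    bZ (A x) w + bX x c * beta - bZ q w + s * beta <
    bZ (b + z) w + r * beta.
  move=> Px Qq s0.
  have Hh : primal_set bX A P Q b c (A x - b - q, bX x c + s).
    by exists x => //; split=> /=; [exists q | rewrite in_itv/= andbT lerDl].
  have := sep _ Hh; rewrite /prod_pairing/= !linearBl linearDl/=.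
  lra.
have [P0 Q0] := (convex_cone0 coneP, convex_cone0 coneQ).
split.
- apply: (ray_bounded_above_le0 _ (bZ (b + z) w + r * beta)) => t t0.
  by have := test 0 0 t P0 Q0 t0; rewrite linear0 !linear0l; lra.
- move=> q Qq; rewrite -oppr_le0.
  apply: (ray_bounded_above_le0 _ (bZ (b + z) w + r * beta)) => t t0.
  have := test 0 _ 0 P0 (convex_cone_scale coneQ t0 Qq) (lexx 0).
  by rewrite linear0 !linear0l linearZl_LR/=; lra.
- move=> x Px; rewrite -oppr_le0.
  apply: (ray_bounded_above_le0 _ (bZ (b + z) w + r * beta)) => t t0.
  have := test _ 0 0 (convex_cone_scale coneP t0 Px) Q0 (lexx 0).
  rewrite linearBr linearNr linearZr_LR adjA linearZ linear0l !linearZl_LR/=.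
  by lra.
- by have := test 0 0 0 P0 Q0 (lexx 0); rewrite linear0 !linear0l; lra.
Qed.

Lemma dual_feasible_normalize (w : W) (beta : R) :
    beta < 0 -> dual_cone bZ Q w -> dual_cone bX P (- As w - beta *: c) ->
  feasible_dual bX bZ As P Q c ((- beta)^-1 *: w).
Proof.
move=> beta0 wQ wP; have k0 : 0 <= (- beta)^-1 by rewrite invr_ge0 oppr_ge0 ltW.
split=> [q Qq|x Px]; first by rewrite linearZr_LR/= mulr_ge0// wQ.
suff -> : - As ((- beta)^-1 *: w) + c = (- beta)^-1 *: (- As w - beta *: c).
  by rewrite linearZr_LR/= mulr_ge0// wP.
rewrite linearZ/= scalerBr scalerN; congr (_ + _).
by rewrite scalerA -scaleNr -mulrN mulVf ?scale1r// oppr_eq0 lt_eqF.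
Qed.

Lemma dual_feasible_recession (w0 w : W) (t : R) :
    0 <= t -> feasible_dual bX bZ As P Q c w0 ->
    dual_cone bZ Q w -> dual_cone bX P (- As w) ->
  feasible_dual bX bZ As P Q c (w0 + t *: w).
Proof.
move=> t0 [w0Q w0P] wQ wP; split=> [q Qq|x Px].
  by rewrite linearDr linearZr_LR/= addr_ge0 ?mulr_ge0 ?w0Q ?wQ.
suff -> : - As (w0 + t *: w) + c = (- As w0 + c) + t *: (- As w).
  by rewrite linearDr linearZr_LR/= addr_ge0 ?mulr_ge0 ?w0P ?wP.
by rewrite linearD linearZ/= opprD scalerN addrAC.
Qed.

(** Dual feasibility is what handles vertical separators (beta = 0): they
    supply only a direction, which needs a feasible starting point. *)
Lemma strict_separation_dual_feasible {z : Z} {r : R} {w : W} {beta : R} :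
    feasible_dual bX bZ As P Q c !=set0 ->
    (forall h, primal_set bX A P Q b c h ->
       prod_pairing bZ (h - (z, r)) (w, beta) < 0) ->
  exists2 w', feasible_dual bX bZ As P Q c w' & r < bZ (b + z) w'.
Proof.
move=> [w0 Fw0] /strict_separation_signs[beta0 wQ wP].
set v := bZ (b + z) w => v0.
case: (ltgtP beta 0) beta0 => // [beta_lt0|betaE] _.
  exists ((- beta)^-1 *: w); first exact: dual_feasible_normalize.
  by rewrite linearZr_LR/= -/v mulrC ltr_pdivlMr ?oppr_gt0//; lra.
move: wP v0; rewrite betaE scale0r subr0 mulr0 addr0 => wP v0.
set v0' := bZ (b + z) w0.
(* This step length makes the objective at least r + 1. *)
pose t := `|r - v0' + 1| / v.
exists (w0 + t *: w).
  by apply: dual_feasible_recession => //; rewrite divr_ge0// ltW.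
rewrite linearDr linearZr_LR/= -/v -/v0' divfK ?gt_eqF//.
by have := ler_norm (r - v0' + 1); lra.
Qed.

End Duality.

Theorem theorem3p1 (R : realType) (X Y Z W : lmodType R)
    (bX : {bilinear X -> Y -> R | *%R & *%R})
    (bZ : {bilinear Z -> W -> R | *%R & *%R})
    (A : {linear X -> Z}) (As : {linear W -> Y})
    (P : set X) (Q : set Z) (b : Z) (c : Y)
    (sepX : separated_pairing bX) (sepZ : separated_pairing bZ)
    (adjA : adjoint_maps bX bZ A As)
    (coneP : convex_cone P) (coneQ : convex_cone Q)
    (feasP : feasible_primal A P Q b !=set0)
    (feasD : feasible_dual bX bZ As P Q c !=set0)
    (z : Z) (r : R) :
  let H := primal_set bX A P Q b c in
  let N := epigraph (dual_value bX bZ As P Q b c) in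
  let assertion_i := ~ N (z, r) in
  let assertion_ii :=
    exists (p : W * R) (gamma : R), forall h : Z * R, H h ->
      prod_pairing bZ h p <= gamma < prod_pairing bZ (z, r) p in
  let assertion_iii :=
    exists p : W * R, forall h : Z * R, H h ->
      prod_pairing bZ (h - (z, r)) p < 0 in
  (assertion_i <-> assertion_ii) /\ (assertion_ii <-> assertion_iii).
Proof.
move=> H N assertion_i assertion_ii assertion_iii.
have i_ii : assertion_i -> assertion_ii.
  move=> /notin_epigraph_dual_value[w Fw rw].
  exists (w, -1), (- bZ b w) => h Hh; apply/andP; split.
    exact: (dual_feasible_separates adjA Fw Hh).
  by move: rw; rewrite /prod_pairing linearDl/=; lra.
have ii_iii : assertion_ii -> assertion_iii.
  move=> [p [gamma sep]]; exists p => h /sep/andP[].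
  by rewrite /prod_pairing/= linearBl/=; lra.
have iii_i : assertion_iii -> assertion_i.
  move=> [[w beta] sep]; apply/notin_epigraph_dual_value.
  exact: (strict_separation_dual_feasible adjA coneP coneQ feasD sep).
by split; split; auto.
Qed.
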